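(* Let $G=(V,p,\mu)$ be a weighted graph with bounded geometry, with ellipticity constant $\alpha>0$. Assume that $G$ satisfies $CD(0,n)$ for some integer $n\ge 1$. Then there exists a constant $C_{DV}>0$, depending only on $n$ and $\alpha$, such that for all $x\in V$ and all real $r>0$, $$\mu(B(x,2r))\le C_{DV}\,\mu(B(x,r)).$$
   Context: Weighted graph: a triple $G=(V,p,\mu)$ where $V$ is a countable (finite or infinite) set, $p:V\times V\to[0,\infty)$, $\mu:V\to(0,\infty)$ (extended to subsets by $\mu(A)=\sum_{x\in A}\mu(x)$). Write $x\sim y$ if $p(x,y)>0$. It is required that each $x$ has finitely many neighbors $y\sim x$ (i.e. $p(x,y)>0$), that $p$ is a Markov kernel ($\sum_{y\sim x}p(x,y)=1$ for every $x$), and that $G$ is connected (any two vertices are joined by a finite path $x_0,\dots,x_N$ with $x_i\sim x_{i+1}$). Loops $x\sim x$ are allowed but not required. Bounded geometry: (i) there is $\alpha>0$ with $p(x,y)\ge\alpha$ whenever $x\sim y$ (ellipticity constant $\alpha$); (ii) reversibility: $p(x,y)\mu(x)=p(y,x)\mu(y)$ for all $x,y$ (so $x\sim y\iff y\sim x$). Distance: $d(x,x)=0$ and, for $x\neq y$, $d(x,y)$ is the minimal number of steps of a path from $x$ to $y$. Balls are $B(x,r)=\{y\in V: d(x,y)\le r\}$. Operators on functions $f,g:V\to\mathbb{R}$: $\Delta f(x)=\sum_{y\sim x}p(x,y)(f(y)-f(x))$; $\Gamma(f,g)=\frac12(\Delta(fg)-f\Delta g-g\Delta f)$, $\Gamma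 f=\Gamma(f,f)$; $\Gamma_2 f=\frac12\Delta(\Gamma f)-\Gamma(f,\Delta f)$. Curvature-dimension condition: $G$ satisfies $CD(K,n)$ if $\Gamma_2 f\ge\frac1n(\Delta f)^2+K\,\Gamma f$ pointwise on $V$ for all functions $f:V\to\mathbb{R}$. *)

(* Defs.v *)
From mathcomp Require Import all_boot all_order all_algebra.
From mathcomp Require Import all_classical all_reals all_analysis.

Set Implicit Arguments.
Unset Strict Implicit.
Unset Printing Implicit Defensive.

Import Order.TTheory GRing.Theory Num.Theory.

Local Open Scope classical_set_scope.
Local Open Scope ring_scope.

(* The walk x = x_0, x_1, ..., x_N = y is encoded by s = [:: x_1; ...; x_N]. *)
Definition is_walk (V : eqType) (e : rel V) (x y : V) (s : seq V) : bool :=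
  path e x s && (last x s == y).

Record weightedGraph (R : realType) := WeightedGraph {
  vertex :> countType;
  kernel : vertex -> vertex -> R;
  weight : vertex -> R;
  kernel_ge0 : forall x y, 0 <= kernel x y;
  weight_gt0 : forall x, 0 < weight x;
  locally_finite : forall x, finite_set [set y | 0 < kernel x y];
  kernel_markov : forall x, \sum_(y \in [set y | 0 < kernel x y]) kernel x y = 1;
  graph_connected : forall x y,
    exists s, is_walk (fun u v => 0 < kernel u v) x y s
}.

Section Defs.
Context {R : realType} (G : weightedGraph R).
Implicit Types (x y : G) (f g : G -> R).

Definition adj : rel G := fun x y => 0 < kernel x y.

Definition nbrs x : set G := [set y | adj x y].

Definition measure_of (A : set G) : \bar R := \esum_(x in A) (weight x)%:E.

Definition reversible : Prop :=
  forall x y, kernel x y * weight x = kernel y x * weight y.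

Definition elliptic (alpha : R) : Prop :=
  forall x y, adj x y -> alpha <= kernel x y.

Definition bounded_geometry (alpha : R) : Prop :=
  [/\ 0 < alpha, elliptic alpha & reversible].

Definition walk_of_length x y : pred nat :=
  fun N => `[< exists2 s, is_walk adj x y s & size s = N >].

Lemma walk_of_length_ex x y : exists N, walk_of_length x y N.
Proof.
have [s hs] := graph_connected x y.
by exists (size s); apply/asboolP; exists s.
Qed.

(* The empty walk gives [dist x x = 0], whether or not there is a loop at x. *)
Definition dist x y : nat := ex_minn (walk_of_length_ex x y).

Definition gball x (r : R) : set G := [set y | (dist x y)%:R <= r].

Definition laplacian f : G -> R :=
  fun x => \sum_(y \in nbrs x) kernel x y * (f y - f x).

Definition Gamma f g : G -> R := fun x =>
  2^-1 * (laplacian (fun z => f z * g z) x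
          - f x * laplacian g x - g x * laplacian f x).

Definition Gamma2 f : G -> R := fun x =>
  2^-1 * laplacian (Gamma f f) x - Gamma f (laplacian f) x.

Definition CD (K n : R) : Prop :=
  forall f x, n^-1 * laplacian f x ^+ 2 + K * Gamma f f x <= Gamma2 f x.

End Defs.

(* Main.v *)
Require Import Defs.
From mathcomp Require Import all_boot all_order all_algebra.
From mathcomp Require Import all_classical all_reals all_analysis.
From mathcomp Require Import ring lra zify.

(** Why the theorem holds.  Following Münch, the logarithm of the heat semigroup
    is replaced by the nonlinear flow du/dt = Delta u + Gamma u: it satisfies the
    gradient and Li-Yau estimates whose proofs for log (P_t f) would need the
    chain rule, which fails on a graph.  It is run here as an explicit Euler scheme with a tiny step h: every maximum principle
    then becomes a one-step inequality between a value and an average of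
    neighbouring values, so that neither existence of the flow nor attained
    extrema on an infinite graph are at stake, and the errors of size h ^ 2 per
    step add up to something small over the total time of order rho ^ 2.

    Expanding Gamma u and Delta u along one step and inserting the curvature
    condition produces the operator [drift u], an average with the weights
    p(x,y) (1 + u(y) - u(x)).  These are nonnegative as long as u is 1-Lipschitz
    along edges, which ellipticity deduces from Gamma u <= alpha / 2.  Hence the
    sup of Gamma u does not grow ([flow_gradient]), and Delta u obeys the Riccati
    inequality behind the Li-Yau bound Delta u >= - n / (2 t) ([flow_li_yau]).
    Integrating the flow along a path gives a Harnack inequality
    ([flow_edge], [flow_chain]).

    The flow is compared with the linear heat equation through two different
    exponentials, for 1-Lipschitz u: e^(u/4) is a supersolution
    ([flow_supersolution]) and e^(c u) is a subsolution for every even integer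
    c >= 2 ([flow_subsolution]).  The former yields lower bounds of u, the
    latter makes the mass sum mu e^(c u) almost nonincreasing ([mass_flow]).

    For doubling, take u_0 = - (alpha / 2) (d(x,.) - rho)_+.
    - Spheres grow at most by the factor 1 / alpha, so for c large depending on
      alpha only, the initial mass is at most 2 V(rho) ([tail_mass]).
    - Under CD(0,n) the linear heat flow displaces mass by at most
      2 sqrt (n t) ([heat_displacement]); at a time of order rho ^ 2 / n at
      least half of the heat started at x is still in B(x,rho), whence
      u(x) >= -4 by the supersolution property.
    - Harnack propagates this to u >= - C on B(x, 4 rho) at a time of order
      rho ^ 2.
    Thus e^(- c C) V(4 rho) <= 2 e V(rho) ([volume_quadruple]), and rounding the
    radius gives the statement for real radii. *)

Import Order.TTheory GRing.Theory Num.Theory.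
Local Open Scope classical_set_scope.
Local Open Scope ring_scope.

Set Implicit Arguments.
Unset Strict Implicit.
Unset Printing Implicit Defensive.

Local Notation kernel := Defs.kernel.

(** * Averages over neighbours *)

Section Averages.
Context {R : realType} (G : weightedGraph R).
Implicit Types (x y z : G) (f g phi psi : G -> R) (s t : seq G) (c : R).

(** The neighbours as a duplicate-free list, so that the list-indexed big
    operators apply to the finitely supported sums of the operators. *)
Definition nbr_seq x : seq G := finmap.enum_fset (fset_set (nbrs x)).

Lemma mem_nbr_seq x y : (y \in nbr_seq x) = adj x y.
Proof.
rewrite /nbr_seq in_fset_set; last exact: locally_finite.
by apply/idP/idP; rewrite inE.
Qed.

Lemma uniq_nbr_seq x : uniq (nbr_seq x).
Proof. exact: finmap.fset_uniq. Qed.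

Definition avg x phi : R := \sum_(y <- nbr_seq x) kernel x y * phi y.

Lemma fsum_nbrsE x (F : G -> R) :
  \sum_(y \in nbrs x) F y = \sum_(y <- nbr_seq x) F y.
Proof. by rewrite fsbig_finite //; exact: locally_finite. Qed.

Lemma eq_avg x phi psi :
  (forall y, adj x y -> phi y = psi y) -> avg x phi = avg x psi.
Proof.
move=> e; rewrite /avg big_seq [RHS]big_seq; apply: eq_bigr => y.
by rewrite mem_nbr_seq => /e ->.
Qed.

Lemma le_avg x phi psi :
  (forall y, adj x y -> phi y <= psi y) -> avg x phi <= avg x psi.
Proof.
move=> e; rewrite /avg big_seq [leRHS]big_seq; apply: ler_sum => y.
by rewrite mem_nbr_seq => /e ?; rewrite ler_wpM2l ?kernel_ge0.
Qed.

Lemma avgD x phi psi : avg x (fun y => phi y + psi y) = avg x phi + avg x psi.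
Proof. by rewrite /avg -big_split; apply: eq_bigr => y _; rewrite mulrDr. Qed.

Lemma avgZ x c phi : avg x (fun y => c * phi y) = c * avg x phi.
Proof. by rewrite /avg mulr_sumr; apply: eq_bigr => y _; rewrite mulrCA. Qed.

Lemma avgN x phi : avg x (fun y => - phi y) = - avg x phi.
Proof. by rewrite /avg -sumrN; apply: eq_bigr => y _; rewrite mulrN. Qed.

Lemma avg1 x : avg x (fun=> 1) = 1.
Proof.
rewrite -[RHS](kernel_markov x) fsum_nbrsE.
by apply: eq_bigr => y _; rewrite mulr1.
Qed.

Lemma avg_cst x c : avg x (fun=> c) = c.
Proof.
rewrite -[RHS](mulr1) -[X in _ = _ * X](avg1 x) -avgZ.
by apply: eq_avg => y _; rewrite mulr1.
Qed.

Lemma kernel_off x y : ~~ adj x y -> kernel x y = 0.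
Proof.
by rewrite /adj -leNgt => h; apply/eqP; rewrite eq_le h kernel_ge0.
Qed.

Lemma avg_sub s x phi : uniq s -> {subset nbr_seq x <= s} ->
  avg x phi = \sum_(y <- s) kernel x y * phi y.
Proof.
move=> us hs; rewrite (bigID (fun y => adj x y)) /= [X in _ + X]big1 ?addr0.
  rewrite -big_filter /avg; apply: perm_big; apply: uniq_perm.
  - exact: uniq_nbr_seq.
  - exact: filter_uniq.
  move=> y; rewrite mem_filter mem_nbr_seq.
  by case h: (adj x y) => //=; apply/esym/hs; rewrite mem_nbr_seq.
by move=> y /kernel_off ->; rewrite mul0r.
Qed.

Lemma sum_le_avg s x phi : uniq s -> (forall y, 0 <= phi y) ->
  \sum_(y <- s) kernel x y * phi y <= avg x phi.
Proof.
move=> us p0.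
have ut : uniq (undup (s ++ nbr_seq x)) by exact: undup_uniq.
rewrite (avg_sub _ ut); last by move=> y; rewrite mem_undup mem_cat orbC => ->.
rewrite [leRHS](bigID (fun y => y \in s)) /= -[leLHS]addr0 lerD //.
  rewrite -[leRHS]big_filter le_eqVlt; apply/orP; left; apply/eqP.
  apply: perm_big; apply: uniq_perm => //; first exact: filter_uniq.
  move=> y; rewrite mem_filter mem_undup mem_cat.
  by case: (y \in s).
by apply: sumr_ge0 => y _; rewrite mulr_ge0 ?kernel_ge0.
Qed.

Lemma avg_ge_term x y phi : (forall z, 0 <= phi z) ->
  kernel x y * phi y <= avg x phi.
Proof. by move=> p0; have := @sum_le_avg [:: y] x phi isT p0; rewrite big_seq1. Qed.

Lemma laplacianE f x : laplacian f x = avg x f - f x.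
Proof.
rewrite /laplacian fsum_nbrsE -[X in _ = _ - X](avg_cst x) -avgN -avgD.
by [].
Qed.

Lemma GammaE f g x :
  Gamma f g x = 2^-1 * avg x (fun y => (f y - f x) * (g y - g x)).
Proof.
rewrite /Gamma !laplacianE.
have -> : avg x (fun y => (f y - f x) * (g y - g x)) =
   avg x (fun y => f y * g y) + (- (g x) * avg x f + (- f x * avg x g + f x * g x)).
  rewrite -!avgZ -[X in _ = _ + (_ + (_ + X))](avg_cst x) -!avgD.
  by apply: eq_avg => y _; ring.
by ring.
Qed.

End Averages.

(** * One step of the linear and nonlinear flows *)

Section Flow.
Context {R : realType} (G : weightedGraph R).
Implicit Types (x y z : G) (f g u phi psi : G -> R) (a b h t N : R).

Definition lipschitz1 f := forall x y, adj x y -> `|f y - f x| <= 1.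

Definition heat_step h f : G -> R := fun x => f x + h * laplacian f x.

Definition velocity u : G -> R := fun x => laplacian u x + Gamma u u x.

Definition flow_step h u : G -> R := fun x => u x + h * velocity u x.

(** The linearization Delta + 2 Gamma(u, .) of the flow at [u] ([driftE]): for
    1-Lipschitz [u] the weights 1 + u(y) - u(x) are nonnegative, so it has a
    maximum principle like the Laplacian. *)
Definition drift u phi : G -> R :=
  fun x => avg x (fun y => (1 + (u y - u x)) * (phi y - phi x)).

Lemma laplacian_avg f x : laplacian f x = avg x (fun y => f y - f x).
Proof. by rewrite laplacianE avgD avg_cst. Qed.

Lemma driftE u phi x : drift u phi x = laplacian phi x + 2 * Gamma u phi x.
Proof.
rewrite laplacian_avg GammaE mulrA divff ?pnatr_eq0 // mul1r -avgD.
by apply: eq_avg => y _; ring.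
Qed.

Lemma laplacian_comb f g h x :
  laplacian (fun y => f y + h * g y) x = laplacian f x + h * laplacian g x.
Proof. by rewrite !laplacianE avgD avgZ; ring. Qed.

Lemma Gamma_comb f g h x :
  Gamma (fun y => f y + h * g y) (fun y => f y + h * g y) x =
  Gamma f f x + 2 * h * Gamma f g x + h ^+ 2 * Gamma g g x.
Proof.
rewrite !GammaE.
rewrite (_ : 2 * h * _ =
  2^-1 * avg x (fun y => 2 * h * ((f y - f x) * (g y - g x)))); last first.
  by rewrite avgZ; ring.
rewrite (_ : h ^+ 2 * _ =
  2^-1 * avg x (fun y => h ^+ 2 * ((g y - g x) * (g y - g x)))); last first.
  by rewrite avgZ; ring.
by rewrite -!mulrDr -!avgD; congr (_ * _); apply: eq_avg => y _; ring.
Qed.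

Lemma Gamma_addr f g1 g2 x :
  Gamma f (fun y => g1 y + g2 y) x = Gamma f g1 x + Gamma f g2 x.
Proof.
by rewrite !GammaE -mulrDr -avgD; congr (_ * _); apply: eq_avg => y _; ring.
Qed.

Lemma Gamma_ge0 f x : 0 <= Gamma f f x.
Proof.
rewrite GammaE mulr_ge0 // -(avg_cst x 0); apply: le_avg => y _.
by rewrite -expr2 sqr_ge0.
Qed.

Lemma Gamma_le f b x : (forall y, adj x y -> `|f y - f x| <= b) ->
  Gamma f f x <= b ^+ 2 / 2.
Proof.
move=> hf; rewrite GammaE mulrC ler_wpM2r // -(avg_cst x (b ^+ 2)).
apply: le_avg => y /hf hy; rewrite -expr2 -real_normK ?num_real //.
by rewrite ler_sqr ?nnegrE // (le_trans _ hy).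
Qed.

Lemma laplacian_le f b x : (forall y, adj x y -> `|f y - f x| <= b) ->
  `|laplacian f x| <= b.
Proof.
move=> hf; rewrite laplacian_avg ler_norml -(avg_cst x b) -avgN.
by apply/andP; split; apply: le_avg => y /hf; rewrite ler_norml => /andP[].
Qed.

(** Jensen: the variance of [phi] under the kernel is nonnegative. *)
Lemma sqr_avg_le x phi : avg x phi ^+ 2 <= avg x (fun y => phi y ^+ 2).
Proof.
rewrite -subr_ge0; set m := avg x phi.
have -> : avg x (fun y => phi y ^+ 2) - m ^+ 2 =
          avg x (fun y => (phi y - m) ^+ 2).
  rewrite (@eq_avg _ _ _ (fun y => (phi y - m) ^+ 2)
            (fun y => phi y ^+ 2 + (- (2 * m) * phi y + m ^+ 2))).
    by rewrite !avgD avgZ avg_cst -/m; ring.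
  by move=> y _; ring.
by rewrite -(avg_cst x 0); apply: le_avg => y _; rewrite sqr_ge0.
Qed.

(** The maximum principle for the drift, with any upper bound [b] in place of a
    maximum, which an infinite graph may lack; the factor 2 bounds the weights
    1 + u(y) - u(x). *)
Lemma drift_le u phi b x : lipschitz1 u -> (forall y, phi y <= b) ->
  drift u phi x <= 2 * (b - phi x).
Proof.
move=> lu hb; rewrite /drift -[leRHS](avg_cst x).
apply: le_avg => y /lu; rewrite ler_norml => /andP[h1 h2].
have := hb y; have := hb x; nra.
Qed.

Section EdgeBounds.
Variable alpha : R.
Hypothesis alpha_gt0 : 0 < alpha.
Hypothesis ell : elliptic G alpha.

Lemma Gamma_ge u x y : adj x y -> alpha / 2 * (u y - u x) ^+ 2 <= Gamma u u x.
Proof.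
move=> xy; rewrite GammaE (mulrC alpha) -mulrA ler_wpM2l //.
have := @avg_ge_term _ _ x y (fun y => (u y - u x) * (u y - u x)).
move=> /(_ (fun z => _)); rewrite -expr2 => h.
apply: le_trans (h _); last by move=> z; rewrite -expr2 sqr_ge0.
by rewrite ler_wpM2r ?sqr_ge0 //; exact: ell.
Qed.

Lemma lipschitz1_Gamma u :
  (forall x, Gamma u u x <= alpha / 2) -> lipschitz1 u.
Proof.
move=> hu x y xy.
have h := le_trans (Gamma_ge u xy) (hu x).
have: (u y - u x) ^+ 2 <= 1 by rewrite -(@ler_pM2l _ (alpha / 2)) ?divr_gt0 // mulr1.
by rewrite -real_normK ?num_real // expr_le1.
Qed.

End EdgeBounds.

Lemma velocity_le u x : lipschitz1 u -> `|velocity u x| <= 3 / 2.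
Proof.
move=> lu; have h1 := laplacian_le (lu x); have h2 := Gamma_le (lu x).
rewrite /velocity; apply: le_trans (ler_normD _ _) _.
rewrite (ger0_norm (Gamma_ge0 u x)); rewrite expr1n in h2; lra.
Qed.

Lemma laplacian_velocity u x :
  laplacian (velocity u) x =
    laplacian (laplacian u) x + laplacian (Gamma u u) x.
Proof. by rewrite !laplacianE /velocity avgD laplacianE; ring. Qed.

Section Curvature.
Variable N : R.
Hypothesis N_ge1 : 1 <= N.
Hypothesis cd : CD G 0 N.

Let N_gt0 : 0 < N. Proof. exact: lt_le_trans ltr01 N_ge1. Qed.

(** The curvature condition, solved for the mixed term that appears when
    Gamma f or Delta f is differentiated along a flow. *)
Lemma bochner f x :
  2 * Gamma f (laplacian f) x <=
    laplacian (Gamma f f) x - 2 / N * laplacian f x ^+ 2.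
Proof.
have := cd f x; rewrite /Gamma2 mul0r addr0 -subr_ge0.
set A := laplacian (Gamma f f) x; set B := Gamma _ _ _.
set c := laplacian f x ^+ 2; lra.
Qed.

(** Along the flow, Gamma u changes to first order by
    2 Gamma(u, Delta u) + 2 Gamma(u, Gamma u) <= drift u (Gamma u), which cannot
    raise its supremum; the error is h ^ 2 Gamma(velocity u). *)
Lemma Gamma_flow_step u h b x : 0 <= h -> h <= 2^-1 -> lipschitz1 u ->
  (forall y, Gamma u u y <= b) ->
  Gamma (flow_step h u) (flow_step h u) x <= b + 5 * h ^+ 2.
Proof.
move=> h0 h1 lu hb.
have hN : Gamma (velocity u) (velocity u) x <= 3 ^+ 2 / 2.
  apply: Gamma_le => y _; apply: le_trans (ler_normB _ _) _.
  have := velocity_le y lu; have := velocity_le x lu; lra.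
have hd := drift_le x lu hb.
rewrite [leLHS]Gamma_comb Gamma_addr; rewrite driftE in hd.
move: hd (bochner u x).
have := hb x; have : 0 <= 2 / N * laplacian u x ^+ 2.
  by rewrite mulr_ge0 ?sqr_ge0 // divr_ge0 // ltW.
set A := Gamma u u x; set B := Gamma u (laplacian u) x.
set D := laplacian _ x; set E := Gamma u _ x; set F := _ / N * _ => F0 hA hd hB.
have : h * (2 * B + 2 * E) <= h * (2 * (b - A)) by rewrite ler_wpM2l //; lra.
have : h ^+ 2 * Gamma (velocity u) (velocity u) x <= h ^+ 2 * (3 ^+ 2 / 2).
  by rewrite ler_wpM2l ?sqr_ge0.
nra.
Qed.

(** Since Delta is linear, Delta u moves without quadratic error, by
    h (drift u (Delta u) + 2 Gamma_2 u) >= h (drift u (Delta u) + (2 / N) (Delta u) ^ 2).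
    A lower bound - 1 / b therefore improves as in the Riccati equation
    M' = - (2 / N) M ^ 2, whose solutions are reciprocals of affine functions. *)
Lemma laplacian_flow_step u h b x : 0 <= h -> 6 * h <= 1 -> lipschitz1 u ->
  1 <= b -> (forall y, - b^-1 <= laplacian u y) ->
  - (b + 2 * h / N)^-1 <= laplacian (flow_step h u) x.
Proof.
move=> h0 h1 lu b1 hb.
have hd : drift u (fun y => - laplacian u y) x <= 2 * (b^-1 + laplacian u x).
  rewrite -[in leRHS](opprK (laplacian u x)).
  by apply: (@drift_le u (fun y => - laplacian u y)) => // y; rewrite lerNl.
have dN : drift u (fun y => - laplacian u y) x = - drift u (laplacian u) x.
  by rewrite /drift -avgN; apply: eq_avg => y _; ring.
rewrite dN driftE in hd.
have hB := bochner u x.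
rewrite [leRHS]laplacian_comb laplacian_velocity.
have hx := hb x.
move: hd hB hx; set D := laplacian (laplacian u) x; set E := laplacian (Gamma u u) x.
set B := Gamma u _ x; set g := laplacian u x => hd hB hx.
have b0 : 0 < b by lra.
have M1 : b^-1 <= 1 by rewrite invf_le1.
have M0 : 0 < b^-1 by rewrite invr_gt0.
have k0 : 0 <= h / N by rewrite divr_ge0 // ltW.
have k1 : h / N <= h by rewrite ler_pdivrMr // ler_peMr.
have key : - b^-1 + 2 * (h / N) * b^-1 ^+ 2 <= g + h * (D + E).
  have H : h * (- (2 * (b^-1 + g)) + 2 / N * g ^+ 2) <= h * (D + E).
    by rewrite ler_wpM2l //; lra.
  have H' : h * (- (2 * (b^-1 + g)) + 2 / N * g ^+ 2) =
            - (2 * h * (b^-1 + g)) + 2 * (h / N) * g ^+ 2.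
    by field; rewrite !gt_eqF.
  rewrite H' in H.
  rewrite -(lerD2l g) in H; apply: le_trans H.
  set M := b^-1 in hx M1 M0 *; set k := h / N in k0 k1 *.
  have e0 : 0 <= g + M by lra.
  rewrite -subr_ge0.
  have -> : g + (- (2 * h * (M + g)) + 2 * k * g ^+ 2) - (- M + 2 * k * M ^+ 2)
    = (g + M) * (1 - 2 * h - 4 * k * M) + 2 * k * (g + M) ^+ 2 by ring.
  apply: addr_ge0; apply: mulr_ge0 => //; [nra | lra | exact: sqr_ge0].
apply: le_trans key.
have -> : 2 * h / N = 2 * (h / N) by rewrite mulrA.
set k := h / N in k0 k1 *.
rewrite lerNl opprD opprK.
have -> : b^-1 - 2 * k * b^-1 ^+ 2 = (b - 2 * k) / b ^+ 2 by field; rewrite gt_eqF.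
rewrite ler_pdivrMr ?exprn_gt0 // [leRHS]mulrC ler_pdivlMr; last by lra.
nra.
Qed.

(** The gradient bound of the linear heat flow keeps the curvature gain
    (2 / N) (Delta f) ^ 2: as (Delta f) ^ 2 is itself a subsolution by Jensen, it
    can be accumulated with the weight t, and Gamma f + (2 t / N) (Delta f) ^ 2
    satisfies the maximum principle up to O(h ^ 2). *)
Lemma heat_gradient f h t b x : 0 <= h -> h <= 1 -> 0 <= t ->
  (forall y, `|laplacian f y| <= 1) ->
  (forall y, Gamma f f y + 2 * t / N * laplacian f y ^+ 2 <= b) ->
  Gamma (heat_step h f) (heat_step h f) x
    + 2 * (t + h) / N * laplacian (heat_step h f) x ^+ 2 <= b + 4 * h ^+ 2.
Proof.
move=> h0 h1 t0 hf hb.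
have hG : Gamma (laplacian f) (laplacian f) x <= 2 ^+ 2 / 2.
  apply: Gamma_le => y _; apply: le_trans (ler_normB _ _) _.
  have := hf y; have := hf x; lra.
have hB := bochner f x.
have hJ := sqr_avg_le x (laplacian f).
have hA : avg x (fun y => Gamma f f y + 2 * t / N * laplacian f y ^+ 2) <= b.
  by rewrite -(avg_cst x b); apply: le_avg => y _; exact: hb.
have hx := hb x.
have h2 : avg x (fun y => laplacian f y ^+ 2) <= 1.
  rewrite -(avg_cst x 1); apply: le_avg => y _.
  by rewrite -real_normK ?num_real // expr_le1.
rewrite [leLHS](_ : _ = Gamma f f x + 2 * h * Gamma f (laplacian f) x
  + h ^+ 2 * Gamma (laplacian f) (laplacian f) x
  + 2 * (t + h) / N * (laplacian f x + h * laplacian (laplacian f) x) ^+ 2); last first.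
  by rewrite [X in X + _]Gamma_comb [in X in _ + X]laplacian_comb.
rewrite avgD avgZ in hA.
rewrite (laplacianE (Gamma f f)) in hB.
rewrite (laplacianE (laplacian f)).
move: hG hB hJ hA hx h2.
set A := Gamma f f x; set B := Gamma f (laplacian f) x; set C := Gamma (laplacian f) _ x.
set g := laplacian f x; set ag := avg x (laplacian f).
set s := avg x (fun y => laplacian f y ^+ 2).
set AG := avg x _ => hG hB hJ hA hx h2.
have iN : 0 <= N^-1 by rewrite invr_ge0 ltW.
have iN1 : N^-1 <= 1 by rewrite invf_le1.
set i := N^-1 in iN iN1 hB hA hx *.
have s0 : 0 <= s by apply: le_trans hJ; exact: sqr_ge0.
have conv : (g + h * (ag - g)) ^+ 2 <= (1 - h) * g ^+ 2 + h * s.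
  have : h * ag ^+ 2 <= h * s by rewrite ler_wpM2l.
  have : 0 <= h * (1 - h) * (ag - g) ^+ 2.
    by apply: mulr_ge0 (sqr_ge0 _); rewrite mulr_ge0 // subr_ge0.
  nra.
have p1 : 2 * (t + h) * i * (g + h * (ag - g)) ^+ 2
   <= 2 * (t + h) * i * ((1 - h) * g ^+ 2 + h * s).
  by rewrite ler_wpM2l // !mulr_ge0 //; lra.
have p2 : h * (2 * B) <= h * (AG - A - 2 * i * g ^+ 2) by rewrite ler_wpM2l.
have p3 : h ^+ 2 * C <= h ^+ 2 * 2 by rewrite ler_wpM2l ?sqr_ge0 //; lra.
have p4 : h * (AG + 2 * t * i * s) <= h * b by rewrite ler_wpM2l.
have p5 : (1 - h) * (A + 2 * t * i * g ^+ 2) <= (1 - h) * b by rewrite ler_wpM2l // subr_ge0.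
have p6 : 2 * h ^+ 2 * (i * s) <= 2 * h ^+ 2 * 1.
  apply: ler_wpM2l; last by nra.
  by apply: mulr_ge0; rewrite ?sqr_ge0.
have p7 : 0 <= 2 * h ^+ 2 * (i * g ^+ 2).
  by apply: mulr_ge0; apply: mulr_ge0; rewrite ?sqr_ge0.
set P := _ * (_ ^+ 2) in p1 *.
nra.
Qed.

End Curvature.
End Flow.

(** * Exponentials as sub- and supersolutions *)

Section Exponential.
Context {R : realType}.
Implicit Types (s t d : R).

Lemma expR_le_quad s : s <= 2^-1 -> expR s <= 1 + s + 2 * s ^+ 2.
Proof.
move=> hs; have h := expR_ge1Dx (- s).
have e : expR s * expR (- s) = 1 by rewrite -expRD subrr expR0.
have p := expR_gt0 s.
have h1 : expR s * (1 - s) <= 1 by rewrite -[leRHS]e ler_wpM2l // ltW.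
have q : 0 < 1 - s by lra.
rewrite -(ler_pM2r q); apply: le_trans h1 _; rewrite -subr_ge0.
have -> : (1 + s + 2 * s ^+ 2) * (1 - s) - 1 = s ^+ 2 * (1 - 2 * s) by ring.
by apply: mulr_ge0; [exact: sqr_ge0 | lra].
Qed.

Lemma bernoulli_ineq (k : nat) t : -1 <= t -> 1 + k%:R * t <= (1 + t) ^+ k.
Proof.
move=> ht; elim: k => [|k ih]; first by rewrite mul0r addr0 expr0.
rewrite exprS; apply: le_trans (_ : (1 + t) * (1 + k%:R * t) <= _).
  rewrite -natr1; have : 0 <= k%:R * t ^+ 2 by rewrite mulr_ge0 ?sqr_ge0.
  nra.
by rewrite ler_wpM2l //; lra.
Qed.

(** Bernoulli applied to ((1 + d) ^ 2) ^ k <= e^(2 k d).  The left-hand side is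
    1 + c (d + d ^ 2 / 2) with c = 2 k, and d + d ^ 2 / 2 is the contribution of
    an edge with increment d to the velocity of the flow. *)
Lemma expR_even_ge (k : nat) d : -1 <= d ->
  1 + k%:R * (2 * d + d ^+ 2) <= expR ((2 * k)%N%:R * d).
Proof.
move=> hd; rewrite natrM mulrAC -mulrA expRM_natl.
apply: le_trans (@bernoulli_ineq k (2 * d + d ^+ 2) _) _.
  by have := sqr_ge0 (1 + d); lra.
have -> : 1 + (2 * d + d ^+ 2) = (1 + d) ^+ 2 by ring.
rewrite -exprM; have h := expR_ge1Dx d.
by rewrite (mulrC d) expRM_natl -!exprM mulnC lerXn2r // nnegrE ?expR_ge0 //; lra.
Qed.

End Exponential.

Section Comparison.
Context {R : realType} (G : weightedGraph R).
Implicit Types (x y z : G) (f g u phi psi : G -> R) (a b h t N : R).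

Lemma heat_stepE h f x : heat_step h f x = (1 - h) * f x + h * avg x f.
Proof. by rewrite /heat_step laplacianE; ring. Qed.

Lemma le_heat_step h f g x : 0 <= h -> h <= 1 -> (forall y, f y <= g y) ->
  heat_step h f x <= heat_step h g x.
Proof.
move=> h0 h1 fg; rewrite !heat_stepE lerD // ler_wpM2l ?subr_ge0 //.
by apply: le_avg => y _.
Qed.

Lemma velocityE u x :
  velocity u x = avg x (fun y => (u y - u x) + (u y - u x) ^+ 2 / 2).
Proof.
rewrite /velocity laplacian_avg GammaE -avgZ -avgD.
by apply: eq_avg => y _; field.
Qed.

Lemma heat_step_exp h c u x : heat_step h (fun y => expR (c * u y)) x =
  expR (c * u x) * (1 + h * (avg x (fun y => expR (c * (u y - u x)) - 1))).
Proof.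
rewrite avgD avg_cst heat_stepE.
have -> : avg x (fun y => expR (c * u y)) =
    expR (c * u x) * avg x (fun y => expR (c * (u y - u x))).
  by rewrite -avgZ; apply: eq_avg => y _; rewrite -expRD; congr expR; ring.
by ring.
Qed.

(** The exponent 1/4 makes c (d + d ^ 2 / 2) >= e^(c d) - 1 true for all
    increments |d| <= 1, so the velocity dominates that of the heat equation. *)
Lemma flow_supersolution h u x : 0 <= h -> lipschitz1 u ->
  heat_step h (fun y => expR (4^-1 * u y)) x <= expR (4^-1 * flow_step h u x).
Proof.
move=> h0 lu; rewrite heat_step_exp /flow_step [in leRHS]mulrDr expRD.
rewrite ler_wpM2l ?expR_ge0 //; apply: le_trans (expR_ge1Dx _).
rewrite lerD2l mulrCA ler_wpM2l // velocityE -avgZ; apply: le_avg => y xy.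
have /= := lu _ _ xy; rewrite ler_norml => /andP[h1 h2].
have /expR_le_quad : 4^-1 * (u y - u x) <= 2^-1 by lra.
by rewrite exprMn; set d := u y - u x; lra.
Qed.

(** For c >= 2 the comparison between c (d + d ^ 2 / 2) and e^(c d) - 1 is
    reversed.  An error quadratic in h remains, from replacing
    e^(c h velocity) by its first-order expansion. *)
Lemma flow_subsolution (k : nat) h u x : 0 <= h -> lipschitz1 u ->
  3 * (2 * k)%N%:R * h <= 1 ->
  expR ((2 * k)%N%:R * flow_step h u x) <=
    heat_step h (fun y => expR ((2 * k)%N%:R * u y)) x
    + 5 * (h * (2 * k)%N%:R) ^+ 2 * expR ((2 * k)%N%:R * u x).
Proof.
move=> h0 lu; set c := (2 * k)%N%:R => hc.
have c0 : 0 <= c by rewrite /c.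
rewrite heat_step_exp /flow_step [in leLHS]mulrDr expRD [X in _ <= _ + X]mulrC -mulrDr.
rewrite ler_wpM2l ?expR_ge0 //.
have hv := velocity_le x lu.
have ch0 : 0 <= h * c by rewrite mulr_ge0.
set v := velocity u x in hv *.
move: hv; rewrite ler_norml => /andP[v1 v2].
apply: le_trans (expR_le_quad _) _; first by nra.
have hle : c * v <= avg x (fun y => expR (c * (u y - u x)) - 1).
  rewrite /v velocityE -avgZ; apply: le_avg => y xy.
  have /= := lu _ _ xy; rewrite ler_norml => /andP[h1 h2].
  have := expR_even_ge k h1; rewrite -/c.
  have -> : k%:R = c / 2 :> R by rewrite /c natrM mulrC mulKf // pnatr_eq0.
  by set d := u y - u x; nra.
set A := avg x _ in hle *.
have h1 : h * (c * v) <= h * A by rewrite ler_wpM2l.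
have h2 : 2 * (c * (h * v)) ^+ 2 <= 5 * (h * c) ^+ 2.
  rewrite (_ : c * (h * v) = (h * c) * v); last by ring.
  rewrite exprMn; have : v ^+ 2 <= 9 / 4 by nra.
  by have := sqr_ge0 (h * c); nra.
by rewrite (mulrCA c); lra.
Qed.

End Comparison.

(** * Estimates along the flows *)

Section Iterates.
Context {R : realType} (G : weightedGraph R).
Implicit Types (x y z : G) (f g u : G -> R) (k : nat).

Lemma heat_bound (N h : R) f k : 1 <= N -> CD G 0 N ->
  0 <= h -> h <= 1 -> lipschitz1 f ->
  (forall y, `|laplacian (iter k (heat_step h) f) y| <= 1) /\
  (forall y, Gamma (iter k (heat_step h) f) (iter k (heat_step h) f) y
      + 2 * (k%:R * h) / N * laplacian (iter k (heat_step h) f) y ^+ 2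
    <= 2^-1 + 4 * h ^+ 2 * k%:R).
Proof.
move=> N1 cd h0 h1 lf; elim: k => [|k [i1 i2]].
  split=> y /=; first exact: laplacian_le (lf y).
  have := Gamma_le (lf y); rewrite expr1n; lra.
rewrite !iterS; set F := iter k _ f in i1 i2 *.
split=> y.
  rewrite laplacian_comb -[_ + _]/(heat_step h (laplacian F) y).
  rewrite ler_norml heat_stepE; apply/andP; split.
    have : - 1 <= avg y (laplacian F).
      rewrite -(avg_cst y (-1)); apply: le_avg => z _.
      by have := i1 z; rewrite ler_norml => /andP[].
    have := i1 y; rewrite ler_norml => /andP[? _] ?; nra.
  have : avg y (laplacian F) <= 1.
    rewrite -[leRHS](avg_cst y 1); apply: le_avg => z _.
    by have := i1 z; rewrite ler_norml => /andP[].
  have := i1 y; rewrite ler_norml => /andP[_ ?] ?; nra.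
have kh0 : 0 <= k%:R * h by rewrite mulr_ge0.
have := heat_gradient N1 cd y h0 h1 kh0 i1 i2.
rewrite -(natr1 k) mulrDl mul1r; lra.
Qed.

(** The bound |Delta f_t| <= sqrt (N / (2 t)) coming from [heat_bound] is
    integrable at t = 0, so f_t(x) <= 2 sqrt (N t).  With f the distance from x this
    bounds the mean displacement of the random walk by a diffusive rate. *)
Lemma heat_displacement (N h : R) f x k : 1 <= N -> CD G 0 N ->
  0 <= h -> h <= 1 -> lipschitz1 f -> (forall y, 0 <= f y) -> f x = 0 ->
  8 * h ^+ 2 * k%:R <= 1 ->
  iter k (heat_step h) f x ^+ 2 <= 4 * N * (k%:R * h).
Proof.
move=> N1 cd h0 h1 lf f0 fx hk.
suff: forall j, (j <= k)%N -> iter j (heat_step h) f x ^+ 2 <= 4 * N * (j%:R * h).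
  by apply.
elim=> [|j ih] jk; first by rewrite /= fx expr0n mul0r mulr0.
have {ih} := ih (ltnW jk).
have [/(_ x) i1 /(_ x)] := heat_bound j N1 cd h0 h1 lf.
have : 0 <= iter j (heat_step h) f x.
  suff: forall i y, 0 <= iter i (heat_step h) f y by apply.
  elim=> [|i ihi] y //=; rewrite heat_stepE addr_ge0 ?mulr_ge0 ?subr_ge0 //.
  by rewrite -(avg_cst y 0); apply: le_avg => z _.
rewrite iterS /(heat_step h _ x).
set F := iter j _ f; have := Gamma_ge0 F x.
move: i1; rewrite -/F; set g := laplacian F x => i1 Gp F0 hG hF.
have g1 : g ^+ 2 <= 1 by rewrite -real_normK ?num_real // expr_le1.
have jk' : (j%:R : R) <= k%:R by rewrite ler_nat ltnW.
have hj : 4 * h ^+ 2 * j%:R <= 2^-1.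
  have : h ^+ 2 * j%:R <= h ^+ 2 * k%:R by rewrite ler_wpM2l ?sqr_ge0.
  by move: hk; lra.
(* At time 0 the bound on Delta f degenerates; |Delta f| <= 1 replaces it. *)
have [j0|j0] := posnP j.
  have -> : F x = 0 by rewrite /F j0.
  rewrite add0r exprMn j0.
  have : h ^+ 2 * g ^+ 2 <= h ^+ 2 * 1 by rewrite ler_wpM2l ?sqr_ge0.
  have : h ^+ 2 <= h by nra.
  have : h <= N * h by rewrite ler_peMl.
  rewrite mul1r; lra.
have j1 : (1 : R) <= j%:R by rewrite ler1n.
set t := j%:R * h in hG hF *.
have ht : h <= t by rewrite /t ler_peMl.
have tg : 2 * (t * g ^+ 2) <= N.
  have : 2 * t / N * g ^+ 2 <= 1 by lra.
  have N0 : 0 < N by lra.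
  by rewrite mulrAC ler_pdivrMr //; lra.
have hN : 2 * (h * g ^+ 2) <= N.
  have : h * g ^+ 2 <= t * g ^+ 2 by rewrite ler_wpM2r ?sqr_ge0.
  lra.
have Fg : F x * g <= 3 / 2 * N.
  rewrite leNgt; apply/negP => hlt.
  have a1 : F x ^+ 2 * g ^+ 2 <= 4 * N * t * g ^+ 2 by rewrite ler_wpM2r ?sqr_ge0.
  have a2 : 2 * N * (2 * (t * g ^+ 2)) <= 2 * N * N by rewrite ler_wpM2l //; lra.
  have : (3 / 2 * N) ^+ 2 < (F x * g) ^+ 2 by rewrite ltr_pXn2r // nnegrE; lra.
  rewrite !exprMn; nra.
have -> : j.+1%:R * h = t + h by rewrite -(natr1 j) mulrDl mul1r.
have b1 : h * (F x * g) <= h * (3 / 2 * N) by rewrite ler_wpM2l.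
have b2 : h * (2 * (h * g ^+ 2)) <= h * N by rewrite ler_wpM2l.
have -> : (F x + h * g) ^+ 2 = F x ^+ 2 + 2 * (h * (F x * g)) + h * (h * g ^+ 2).
  by ring.
have : 0 <= h * N by rewrite mulr_ge0 //; lra.
lra.
Qed.

Section Flow.
Variables (N alpha h : R) (K : nat) (u0 : G -> R).
Let flow k := iter k (flow_step h) u0.

Lemma flow_gradient : 1 <= N -> CD G 0 N -> 0 < alpha -> elliptic G alpha ->
  0 <= h -> 6 * h <= 1 -> (forall x, Gamma u0 u0 x <= alpha / 4) ->
  20 * h ^+ 2 * K%:R <= alpha ->
  forall k, (k <= K)%N -> lipschitz1 (flow k).
Proof.
move=> N1 cd a0 ell h0 h6 g0 hK k kK.
suff [] : (forall x, Gamma (flow k) (flow k) x <= alpha / 4 + 5 * h ^+ 2 * k%:R)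
          /\ lipschitz1 (flow k) by [].
elim: k kK => [|k ih] kK.
  split; first by move=> x; rewrite mulr0 addr0; exact: g0.
  by apply: (lipschitz1_Gamma a0 ell) => x; have := g0 x; rewrite /flow /=; lra.
have [i1 i2] := ih (ltnW kK).
have h2 : h <= 2^-1 by lra.
have H x : Gamma (flow k.+1) (flow k.+1) x <= alpha / 4 + 5 * h ^+ 2 * k.+1%:R.
  by have := Gamma_flow_step N1 cd x h0 h2 i2 i1; rewrite -(natr1 k) /flow iterS; lra.
split=> //; apply: (lipschitz1_Gamma a0 ell) => x; apply: le_trans (H x) _.
have : h ^+ 2 * k.+1%:R <= h ^+ 2 * K%:R by rewrite ler_wpM2l ?sqr_ge0 ?ler_nat.
by lra.
Qed.

Hypothesis flow_lip : forall k, (k <= K)%N -> lipschitz1 (flow k).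

(** The Li-Yau inequality: the initial bound - 1 comes from the Lipschitz
    condition, and time t = k h turns it into - 1 / (1 + 2 t / N). *)
Lemma flow_li_yau : 1 <= N -> CD G 0 N -> 0 <= h -> 6 * h <= 1 ->
  forall k x, (k <= K)%N -> - (1 + k%:R * (2 * h / N))^-1 <= laplacian (flow k) x.
Proof.
move=> N1 cd h0 h6; elim=> [|k ih] x kK.
  rewrite mul0r addr0 invr1; have := laplacian_le (@flow_lip 0 kK x).
  by rewrite ler_norml => /andP[].
rewrite -(natr1 k) mulrDl mul1r addrA.
have := laplacian_flow_step N1 cd x h0 h6 (flow_lip (ltnW kK)) _ (ih ^~ (ltnW kK)).
apply; rewrite lerDl mulr_ge0 // divr_ge0 ?mulr_ge0 //; lra.
Qed.

(** The supersolution e^(u/4) stays above the heat flow of its initial value;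
    the latter is minorized by an affine function of [f], because the heat flow of
    an indicator is not explicit but that of [f] is controlled. *)
Lemma flow_lower f s : 0 <= h -> h <= 1 ->
  (forall y, 1 - s * f y <= expR (4^-1 * u0 y)) ->
  forall k y, (k <= K)%N ->
    1 - s * iter k (heat_step h) f y <= expR (4^-1 * flow k y).
Proof.
move=> h0 h1 hf; elim=> [|k ih] y kK; first exact: hf.
rewrite /flow !iterS; apply: le_trans (flow_supersolution y h0 (flow_lip (ltnW kK))).
apply: le_trans (le_heat_step y h0 h1 (ih ^~ (ltnW kK))).
set F := iter k _ f; rewrite !heat_stepE avgD avg_cst.
have -> : avg y (fun z => - (s * F z)) = - (s * avg y F).
  by rewrite avgN avgZ.
by rewrite le_eqVlt; apply/orP; left; apply/eqP; ring.
Qed.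

Section Harnack.
Variables (k0 : nat) (m : R).
Hypothesis m_bound :
  forall k y, (k0 <= k <= K)%N -> - m <= laplacian (flow k) y.

(** Where Delta u >= - m, a value can only decay at rate m, as Gamma u >= 0. *)
Lemma flow_wait j y : 0 <= h -> (k0 + j <= K)%N ->
  flow k0 y - j%:R * (h * m) <= flow (k0 + j) y.
Proof.
move=> h0; elim: j => [|j ih]; first by rewrite addn0 mul0r subr0.
rewrite addnS => jK.
rewrite -[flow _.+1 y]/(flow (k0 + j) y + h * velocity (flow (k0 + j)) y).
have /ih H := ltnW jK.
have := @m_bound (k0 + j) y; rewrite leq_addr ltnW // => /(_ isT) hm.
have := Gamma_ge0 (flow (k0 + j)) y => hG.
have : h * (- m) <= h * velocity (flow (k0 + j)) y.
  by rewrite ler_wpM2l // /velocity; lra.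
by rewrite -(natr1 j); lra.
Qed.

Hypotheses (alpha_gt0 : 0 < alpha) (alpha_le1 : alpha <= 1)
  (ell : elliptic G alpha) (h_ge0 : 0 <= h) (h_le1 : h <= 1).

(** While u(y) lies below u(x), the term Gamma u(y) >= (alpha / 2) (u(x) - u(y)) ^ 2
    pushes it up.  The deficit e of u(y) with respect to the decaying barrier
    u(x) - m t thus satisfies e' <= - (alpha / 2) e ^ 2, and e <= 1 at the start, so
    e <= 1 / (1 + alpha t / 2) after time t. *)
Lemma flow_edge j x y : adj x y -> adj y x -> (k0 + j <= K)%N ->
  flow k0 x - j%:R * (h * m) - (1 + j%:R * (h * alpha / 2))^-1
    <= flow (k0 + j) y.
Proof.
move=> xy yx; elim: j => [|j ih] jK.
  rewrite !mul0r subr0 addr0 invr1 addn0.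
  rewrite addn0 in jK; have := flow_lip jK xy; rewrite ler_norml; lra.
rewrite addnS in jK; have {ih} H := ih (ltnW jK).
have hw := flow_wait x h_ge0 (ltnW jK).
have := @m_bound (k0 + j) y; rewrite leq_addr ltnW // => /(_ isT) hm.
have hG := Gamma_ge ell (flow (k0 + j)) yx.
rewrite addnS.
rewrite -[flow _.+1 y]/(flow (k0 + j) y + h * velocity (flow (k0 + j)) y).
rewrite /velocity.
set v := flow (k0 + j) in H hw hm hG *.
have hG0 := Gamma_ge0 v y.
move: H hw hm hG hG0; rewrite -(natr1 j) !mulrDl !mul1r; set q := h * alpha / 2.
set X := flow k0 x - _; set b := 1 + j%:R * q.
set D := laplacian v y; set E := Gamma v v y => H hw hm hG hG0.
have q0 : 0 <= q by rewrite /q; apply: divr_ge0 => //; rewrite mulr_ge0 // ltW.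
have q1 : q <= 2^-1 by rewrite /q -[leRHS]mul1r ler_wpM2r // mulr_ile1 // ltW.
have b1 : 1 <= b by rewrite /b lerDl mulr_ge0.
have b0 : 0 < b by lra.
have -> : 1 + (j%:R * q + q) = b + q by rewrite /b addrA.
have -> : flow k0 x - (j%:R * (h * m) + h * m) = X - h * m by rewrite /X; ring.
have hmD : h * (- m) <= h * D by rewrite ler_wpM2l.
have [e0|e0] := leP (X - v y) 0.
  have : 0 <= (b + q)^-1 by rewrite invr_ge0; lra.
  have : 0 <= h * E by rewrite mulr_ge0.
  lra.
have hE : q * (X - v y) ^+ 2 <= h * E.
  have : (X - v y) ^+ 2 <= (v x - v y) ^+ 2 by rewrite ler_sqr ?nnegrE; lra.
  move=> hsq; rewrite /q -mulrA -mulrA ler_wpM2l //; apply: le_trans hG.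
  by rewrite mulrA ler_wpM2l // divr_ge0 // ltW.
have eb : X - v y <= b^-1 by lra.
suff : (X - v y) - q * (X - v y) ^+ 2 <= (b + q)^-1 by lra.
set e := X - v y in e0 eb hE *.
have ib1 : b^-1 <= 1 by rewrite invf_le1.
apply: le_trans (_ : b^-1 - q * b^-1 ^+ 2 <= _).
  rewrite -subr_ge0.
  have -> : b^-1 - q * b^-1 ^+ 2 - (e - q * e ^+ 2) = (b^-1 - e) * (1 - q * (b^-1 + e)) by ring.
  by apply: mulr_ge0; [lra|nra].
have -> : b^-1 - q * b^-1 ^+ 2 = (b - q) / b ^+ 2 by field; rewrite gt_eqF.
rewrite ler_pdivrMr ?exprn_gt0 // [leRHS]mulrC ler_pdivlMr; last by lra.
by have := sqr_ge0 q; nra.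
Qed.

End Harnack.
End Flow.
End Iterates.

(** * Balls, spheres and mass *)

Section Balls.
Context {R : realType} (G : weightedGraph R).
Implicit Types (x y z : G) (s t : seq G) (k r : nat).

Lemma dist_le_walk x y s : is_walk (@adj R G) x y s -> (dist x y <= size s)%N.
Proof.
move=> w; rewrite /dist; case: ex_minnP => m _; apply.
by apply/asboolP; exists s.
Qed.

Lemma dist_walk x y : exists2 s, is_walk (@adj R G) x y s & size s = dist x y.
Proof. by rewrite /dist; case: ex_minnP => m /asboolP. Qed.

Lemma dist_refl x : dist x x = 0%N.
Proof.
by apply/eqP; rewrite -leqn0; apply: (@dist_le_walk x x [::]); rewrite /is_walk /= eqxx.
Qed.

Lemma dist_adj x y z : adj y z -> (dist x z <= (dist x y).+1)%N.
Proof.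
move=> yz; have [s /andP[ps /eqP ls] <-] := dist_walk x y.
rewrite -(size_rcons s z); apply: dist_le_walk.
by rewrite /is_walk rcons_path ps ls yz last_rcons eqxx.
Qed.

Lemma dist_eq0 x y : dist x y = 0%N -> y = x.
Proof.
by have [[|z s] /andP[_ /eqP ls] <-] := dist_walk x y.
Qed.

Lemma dist_pred x z k : dist x z = k.+1 -> exists2 y, dist x y = k & adj y z.
Proof.
move=> dz; have [s] := dist_walk x z; case/lastP: s => [|s w].
  by rewrite dz.
rewrite /is_walk rcons_path last_rcons size_rcons dz => /andP[/andP[ps sw] /eqP wz] [sk].
rewrite wz in sw; exists (last x s) => //; apply/eqP; rewrite eqn_leq.
have := @dist_le_walk x (last x s) s; rewrite /is_walk ps eqxx sk => -> //=.
by rewrite -ltnS -dz; apply: dist_adj.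
Qed.

Fixpoint ball_seq x k : seq G :=
  if k is k'.+1
  then undup (ball_seq x k' ++ flatten [seq nbr_seq y | y <- ball_seq x k'])
  else [:: x].

Lemma uniq_ball_seq x k : uniq (ball_seq x k).
Proof. by case: k => //= k; exact: undup_uniq. Qed.

Lemma mem_ball_seq x k z : (z \in ball_seq x k) = (dist x z <= k)%N.
Proof.
elim: k z => [|k ih] z /=.
  rewrite inE leqn0; apply/eqP/eqP => [->|/dist_eq0 //].
  exact: dist_refl.
rewrite mem_undup mem_cat ih [RHS]leq_eqVlt (ltnS _ k).
apply/orP/orP => [[->|/flattenP[_ /mapP[y yk ->]]]|[/eqP dz|->]]; [by right| |  |by left].
  rewrite mem_nbr_seq => yz; rewrite ih in yk.
  by apply/orP; rewrite -ltnS -leq_eqVlt; apply: leq_trans (dist_adj x yz) _.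
have [y yk yz] := dist_pred dz; right.
by apply/flattenP; exists (nbr_seq y); rewrite ?mem_nbr_seq // map_f // ih yk.
Qed.

Section Volume.
Variable x : G.

Definition volume k := \sum_(z <- ball_seq x k) weight z.
Definition sphere k := [seq z <- ball_seq x k | dist x z == k].
Definition area k := \sum_(z <- sphere k) weight z.

Lemma mem_sphere k z : (z \in sphere k) = (dist x z == k).
Proof. by rewrite mem_filter mem_ball_seq; case: eqP => //= ->; rewrite leqnn. Qed.

Lemma area_ge0 k : 0 <= area k.
Proof. by apply: sumr_ge0 => z _; exact: ltW (weight_gt0 z). Qed.

Lemma sum_ballS k (F : G -> R) : \sum_(z <- ball_seq x k.+1) F z =
  \sum_(z <- ball_seq x k) F z + \sum_(z <- sphere k.+1) F z.
Proof.
rewrite (bigID (fun z => dist x z <= k)%N) /= -big_filter -[X in _ + X]big_filter.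
congr (_ + _); apply: perm_big; apply: uniq_perm;
  rewrite ?filter_uniq ?undup_uniq ?uniq_ball_seq // => z.
  rewrite mem_filter -/(ball_seq x k.+1) !mem_ball_seq; lia.
rewrite mem_filter -/(ball_seq x k.+1) mem_ball_seq mem_sphere; lia.
Qed.

Lemma area_le_volume k : area k <= volume k.
Proof.
rewrite /area /volume big_filter big_mkcond; apply: ler_sum => z _.
by case: ifP => // _; exact: ltW (weight_gt0 z).
Qed.

Lemma le_volume k r : (k <= r)%N -> volume k <= volume r.
Proof.
move=> /subnK <-; elim: (r - k)%N => [|j ih] //; rewrite addSn.
by apply: le_trans ih _; rewrite /volume sum_ballS lerDl area_ge0.
Qed.

Lemma volume_ge0 k : 0 <= volume k.
Proof. by apply: le_trans (area_le_volume k); exact: area_ge0. Qed.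

End Volume.

End Balls.

Section Mass.
Context {R : realType} (G : weightedGraph R).
Implicit Types (x y z : G) (s t : seq G) (k r : nat) (w : G -> R) (M : R).

(** Bounds on all finite partial sums: a bound on the total mass of a
    nonnegative [w] that does not presuppose its summability. *)
Definition mass_le w M := forall s, uniq s ->
  \sum_(z <- s) weight z * w z <= M.

Hypothesis rev : reversible G.

Lemma adj_sym y z : adj y z -> adj z y.
Proof.
rewrite /adj => yz; have := rev z y; have := weight_gt0 z; have := weight_gt0 y.
move=> wy wz e; have : 0 < kernel z y * weight z by rewrite e mulr_gt0.
by rewrite pmulr_lgt0.
Qed.

Lemma sum_kernel_le s y : uniq s -> \sum_(z <- s) kernel y z <= 1.
Proof.
move=> us; rewrite -(avg1 y).
have := @sum_le_avg _ _ s y (fun=> 1) us (fun=> ler01).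
by under eq_bigr do rewrite mulr1.
Qed.

(** The measure is invariant under the reversible kernel: by detailed balance
    the sum over [s] becomes one over the neighbours of [s], in which every vertex
    y is counted with weight at most sum_z p(y,z) = 1. *)
Lemma mass_avg w M : (forall x, 0 <= w x) -> mass_le w M -> mass_le (fun x => avg x w) M.
Proof.
move=> w0 hw s us.
pose t := undup (flatten [seq nbr_seq x | x <- s]).
have ut : uniq t by exact: undup_uniq.
have -> : \sum_(z <- s) weight z * avg z w =
    \sum_(z <- s) \sum_(y <- t) weight y * w y * kernel y z.
  rewrite big_seq [RHS]big_seq; apply: eq_bigr => z zs.
  rewrite (@avg_sub _ _ t) //.
    rewrite mulr_sumr; apply: eq_bigr => y _.
    by rewrite mulrA (mulrC (weight z)) rev; ring.
  move=> y yz; rewrite mem_undup; apply/flattenP; exists (nbr_seq z) => //.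
  exact: map_f.
rewrite exchange_big /=; apply: le_trans (hw t ut).
apply: ler_sum => y _; rewrite -mulr_sumr ler_piMr ?sum_kernel_le //.
by rewrite mulr_ge0 // ltW // weight_gt0.
Qed.

Lemma mass_heat (h : R) w M : 0 <= h -> h <= 1 -> (forall x, 0 <= w x) ->
  mass_le w M -> mass_le (heat_step h w) M.
Proof.
move=> h0 h1 w0 hw s us.
have -> : \sum_(z <- s) weight z * heat_step h w z =
  (1 - h) * \sum_(z <- s) weight z * w z + h * \sum_(z <- s) weight z * avg z w.
  rewrite !mulr_sumr -big_split; apply: eq_bigr => z _ /=.
  by rewrite heat_stepE; ring.
have a1 := hw s us; have a2 := mass_avg w0 hw us; nra.
Qed.

Lemma mass_flow (h : R) (K k : nat) u0 M : 0 <= h -> h <= 1 ->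
  (forall k, (k <= K)%N -> lipschitz1 (iter k (flow_step h) u0)) ->
  3 * (2 * k)%N%:R * h <= 1 ->
  mass_le (fun z : G => expR ((2 * k)%N%:R * u0 z)) M ->
  forall i, (i <= K)%N ->
  mass_le (fun z => expR ((2 * k)%N%:R * iter i (flow_step h) u0 z))
    ((1 + 5 * (h * (2 * k)%N%:R) ^+ 2) ^+ i * M).
Proof.
move=> h0 h1 lip hc h2; elim=> [|i ih] iK; first by rewrite expr0 mul1r.
move=> s us; have {ih} H := ih (ltnW iK).
set v := iter i _ u0 in H; set c := (2 * k)%N%:R in hc h2 H *.
set e := 5 * _; rewrite exprS -mulrA mulrDl mul1r.
set B := _ * M in H *.
apply: le_trans (_ : \sum_(z <- s)
  (weight z * heat_step h (fun y => expR (c * v y)) z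
   + e * (weight z * expR (c * v z))) <= _).
  apply: ler_sum => z _.
  have := flow_subsolution z h0 (lip _ (ltnW iK)) hc; rewrite -/v -/c -/e => hs.
  rewrite mulrCA -mulrDr ler_wpM2l //; exact: ltW (weight_gt0 z).
rewrite big_split /= -mulr_sumr lerD //.
  by apply: mass_heat => // x; exact: expR_ge0.
rewrite ler_wpM2l // ?H // /e mulr_ge0 // sqr_ge0 //.
Qed.

Section Tail.
Variables (alpha : R) (x : G).
Hypotheses (alpha_gt0 : 0 < alpha) (ell : elliptic G alpha).

(** Each vertex z of the outer sphere has a neighbour y in the inner one, and
    alpha mu(z) <= p(z,y) mu(z) = p(y,z) mu(y); summing over z spends at most the
    total mass 1 of p(y, .). *)
Lemma area_growth k : area x k.+1 <= alpha^-1 * area x k.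
Proof.
have us : uniq (sphere x k.+1) by rewrite filter_uniq ?uniq_ball_seq.
apply: le_trans (_ : \sum_(z <- sphere x k.+1) \sum_(y <- sphere x k)
  alpha^-1 * weight y * kernel y z <= _).
  rewrite /area big_seq [leRHS]big_seq; apply: ler_sum => z.
  rewrite mem_sphere => /eqP /dist_pred[y dy yz].
  rewrite (bigD1_seq y) /=; last 2 first.
  - by rewrite mem_sphere dy.
  - by rewrite filter_uniq ?uniq_ball_seq.
  apply: ler_wpDr.
    apply: sumr_ge0 => y' _; rewrite mulr_ge0 ?kernel_ge0 //.
    by rewrite mulr_ge0 ?invr_ge0 ?(ltW alpha_gt0) ?(ltW (weight_gt0 _)).
  rewrite -mulrA ler_pdivlMl // (mulrC (weight y)) rev.
  by rewrite ler_wpM2r ?(ltW (weight_gt0 _)) //; apply: ell; exact: adj_sym.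
rewrite exchange_big /= /area mulr_sumr; apply: ler_sum => y _.
rewrite -mulr_sumr ler_piMr ?sum_kernel_le //.
by rewrite mulr_ge0 ?invr_ge0 ?(ltW alpha_gt0) ?(ltW (weight_gt0 _)).
Qed.

(** With q <= alpha / 2 the weight q ^ j beats the growth alpha ^ (- j) of the
    spheres, and the tail is dominated by a geometric series of ratio 1/2. *)
Lemma tail_mass (q : R) (rho : nat) : 0 <= q -> q <= alpha / 2 ->
  mass_le (fun z => q ^+ (dist x z - rho)) (2 * volume x rho).
Proof.
move=> q0 qa s us.
have hs j : q ^+ j * area x (rho + j) <= 2^-1 ^+ j * volume x rho.
  elim: j => [|j ih]; first by rewrite !expr0 !mul1r addn0 area_le_volume.
  rewrite addnS !exprS -!mulrA.
  apply: le_trans (_ : q * (alpha^-1 * (q ^+ j * area x (rho + j))) <= _).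
    rewrite ler_wpM2l // mulrCA ler_wpM2l ?exprn_ge0 //; exact: area_growth.
  rewrite [leLHS]mulrA; apply: ler_pM => //.
  - by rewrite mulr_ge0 // invr_ge0 ltW.
  - by rewrite mulr_ge0 ?exprn_ge0 ?area_ge0.
  by rewrite ler_pdivrMr // mulrC.
have hb j : \sum_(z <- ball_seq x (rho + j)) weight z * q ^+ (dist x z - rho)
    <= (2 - 2^-1 ^+ j) * volume x rho.
  elim: j => [|j ih].
    rewrite addn0 expr0 (_ : 2 - 1 = 1); last by lra.
    rewrite mul1r le_eqVlt; apply/orP; left; apply/eqP.
    rewrite /volume big_seq [RHS]big_seq; apply: eq_bigr => z.
    by rewrite mem_ball_seq -subn_eq0 => /eqP ->; rewrite expr0 mulr1.
  rewrite addnS sum_ballS.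
  have -> : \sum_(z <- sphere x (rho + j).+1) weight z * q ^+ (dist x z - rho)
     = q ^+ j.+1 * area x (rho + j.+1).
    rewrite addnS mulr_sumr big_seq [RHS]big_seq; apply: eq_bigr => z.
    by rewrite mem_sphere => /eqP ->; rewrite mulrC -addnS addKn.
  have := hs j.+1; rewrite !exprS; set a := 2^-1 ^+ j in ih *; lra.
pose J := \max_(z <- s) dist x z.
apply: le_trans (le_trans (hb J) _); last first.
  by rewrite ler_wpM2r ?volume_ge0 // gerBl exprn_ge0.
rewrite [leRHS](bigID (fun z => z \in s)) /= -[leLHS]addr0 lerD //.
  rewrite -[leRHS]big_filter le_eqVlt; apply/orP; left; apply/eqP.
  apply: perm_big; apply: uniq_perm => //; first by rewrite filter_uniq ?uniq_ball_seq.
  move=> z; rewrite mem_filter mem_ball_seq.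
  case zs: (z \in s) => //=; apply/esym.
  by apply: leq_trans (leq_addl _ _); exact: leq_bigmax_seq.
apply: sumr_ge0 => z _; rewrite mulr_ge0 ?exprn_ge0 //; exact: ltW (weight_gt0 z).
Qed.

End Tail.
End Mass.

(** * From the flow to doubling *)

Section Doubling.
Context {R : realType} (G : weightedGraph R).
Implicit Types (x y z : G) (rho : nat).

(** Harnack inequality: one edge every [j] steps.  A vertex closer than [i]
    edges is reached by waiting. *)
Lemma flow_chain (alpha h m : R) (K k0 j : nat) u0 x :
  (forall k, (k <= K)%N -> lipschitz1 (iter k (flow_step h) u0)) ->
  (forall k y, (k0 <= k <= K)%N -> - m <= laplacian (iter k (flow_step h) u0) y) ->
  reversible G -> 0 < alpha -> alpha <= 1 -> elliptic G alpha ->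
  0 <= h -> h <= 1 ->
  forall i z, (k0 + i * j <= K)%N -> (dist x z <= i)%N ->
  iter k0 (flow_step h) u0 x
    - i%:R * (j%:R * (h * m) + (1 + j%:R * (h * alpha / 2))^-1)
  <= iter (k0 + i * j) (flow_step h) u0 z.
Proof.
move=> lip hm rev a0 a1 ell h0 h1; elim=> [|i ih] z iK.
  by rewrite leqn0 mul0n addn0 mul0r subr0 => /eqP /dist_eq0 ->.
have iK' : (k0 + i * j + j <= K)%N by rewrite -addnA -mulSnr.
have iK0 : (k0 + i * j <= K)%N by apply: leq_trans iK'; exact: leq_addr.
have hm' k y : (k0 + i * j <= k <= K)%N -> - m <= laplacian (iter k (flow_step h) u0) y.
  by move=> /andP[hk kK]; apply: hm; rewrite kK andbT (leq_trans _ hk) // leq_addr.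
set e := (1 + _)^-1.
have e0 : 0 <= e.
  by rewrite invr_ge0 addr_ge0 // mulr_ge0 // divr_ge0 // mulr_ge0 // ltW.
rewrite mulSnr addnA -(natr1 i) mulrDl mul1r leq_eqVlt => /orP[/eqP dz|].
  have [y dy yz] := dist_pred dz.
  have hy := ih y iK0; rewrite dy leqnn in hy; move/(_ isT): hy => hy.
  have := flow_edge lip hm' a0 a1 ell h0 h1 yz (adj_sym rev yz) iK'.
  rewrite -/e; rewrite -/e in hy; lra.
rewrite ltnS => dz; have := ih z iK0 dz; rewrite -/e => hz.
have := flow_wait hm' z h0 iK'; lra.
Qed.

Lemma initial_gradient (alpha : R) x rho : reversible G ->
  0 < alpha -> alpha <= 1 -> forall y,
  Gamma (fun z => - (alpha / 2) * (dist x z - rho)%N%:R)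
        (fun z => - (alpha / 2) * (dist x z - rho)%N%:R) y <= alpha / 4.
Proof.
move=> rev a0 a1 y; apply: le_trans (_ : (alpha / 2) ^+ 2 / 2 <= _); last first.
  by rewrite expr2; nra.
apply: Gamma_le => z yz; rewrite -mulrBr normrM normrN (@ger0_norm _ (alpha / 2)); last by lra.
rewrite ler_piMr //; first lra.
have d1 := dist_adj x yz; have d2 := dist_adj x (adj_sym rev yz).
have e1 : ((dist x z - rho)%N%:R : R) <= (dist x y - rho)%N%:R + 1.
  by rewrite natr1 ler_nat; lia.
have e2 : ((dist x y - rho)%N%:R : R) <= (dist x z - rho)%N%:R + 1.
  by rewrite natr1 ler_nat; lia.
by rewrite ler_norml; lra.
Qed.

Lemma dist_lipschitz x : reversible G -> lipschitz1 (fun z : G => (dist x z)%:R : R).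
Proof.
move=> rev y z yz.
have d1 := dist_adj x yz; have d2 := dist_adj x (adj_sym rev yz).
have e1 : ((dist x z)%:R : R) <= (dist x y)%:R + 1 by rewrite natr1 ler_nat.
have e2 : ((dist x y)%:R : R) <= (dist x z)%:R + 1 by rewrite natr1 ler_nat.
by rewrite ler_norml; lra.
Qed.

(** The exponent c = 2 k is chosen so large that e^(- c alpha / 2) <= alpha / 2,
    which is what [tail_mass] asks for.  In the proof h is the time step, K' h =
    rho ^ 2 / (16 n) is the time at which [heat_displacement] still keeps half of
    the heat near the centre, and then 4 rho edges are crossed, each in time
    j h = rho. *)
Lemma volume_quadruple (n k : nat) (alpha : R) x rho :
  (1 <= n)%N -> 0 < alpha -> alpha <= 1 -> elliptic G alpha -> reversible G ->
  CD G 0 n%:R -> (1 <= k)%N -> expR (- (alpha / 2) * (2 * k)%N%:R) <= alpha / 2 ->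
  (1 <= rho)%N ->
  volume x (4 * rho) <=
    2 * expR (1 + (2 * k)%N%:R * (4 + 32 * n%:R ^+ 2 + 8 / alpha)) * volume x rho.
Proof.
move=> n1 a0 a1 ell rev cd k1 hk rho1.
have N1 : (1 : R) <= n%:R by rewrite ler1n.
have r1 : (1 : R) <= rho%:R by rewrite ler1n.
set N : R := n%:R in N1 *; set r : R := rho%:R in r1 *.
set c : R := (2 * k)%N%:R.
have c0 : 0 <= c by rewrite /c.
(* The three terms make the error in the gradient bound, the exponent of one
   mass step and the accumulated error of the mass small, respectively. *)
pose bnd := 100 * r ^+ 2 / alpha + 3 * c + 25 * (r * c) ^+ 2.
have b1 : 0 <= 100 * r ^+ 2 / alpha.
  by apply: divr_ge0; [apply: mulr_ge0 => //; exact: sqr_ge0 | exact: ltW].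
have b3 : 0 <= 25 * (r * c) ^+ 2 by apply: mulr_ge0 => //; exact: sqr_ge0.
have bnd0 : 0 <= bnd by rewrite /bnd; lra.
pose N' := (Num.bound bnd).+1.
have hX : bnd <= N'%:R.
  by rewrite /N' -natr1; have := archi_boundP bnd0; lra.
set X : R := N'%:R in hX.
have X1 : 1 <= X by rewrite /X ler1n.
pose h : R := (16 * N * X)^-1.
have NX1 : 1 <= N * X by nra.
have h0 : 0 < h by rewrite invr_gt0; nra.
have hNX : h * (16 * N * X) = 1 by rewrite mulVf // gt_eqF //; nra.
have hX1 : h * X <= 16^-1.
  have : h * X <= h * (N * X) by rewrite ler_wpM2l ?(ltW h0) //; nra.
  by lra.
have h6 : 6 * h <= 1 by nra.
have h1 : h <= 1 by lra.
have hbnd : h * bnd <= 1.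
  apply: le_trans (_ : h * X <= _); last by lra.
  by rewrite ler_wpM2l // ltW.
have hb1 : 100 * r ^+ 2 * h <= alpha.
  have : h * (100 * r ^+ 2 / alpha) <= 1.
    apply: le_trans hbnd; rewrite ler_wpM2l ?(ltW h0) // /bnd; lra.
  by rewrite mulrA ler_pdivrMr // mul1r mulrC.
have hb2 : 3 * c * h <= 1.
  apply: le_trans hbnd; rewrite mulrC ler_wpM2l ?(ltW h0) // /bnd; lra.
have hb3 : h * (25 * (r * c) ^+ 2) <= 1.
  apply: le_trans hbnd; rewrite ler_wpM2l ?(ltW h0) // /bnd; lra.
pose K' := (rho ^ 2 * N')%N.
pose j := (16 * n * rho * N')%N.
pose K := (K' + 4 * rho * j)%N.
have hK' : K'%:R * h = r ^+ 2 / (16 * N).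
  rewrite /K' natrM natrX -/r -/X /h; field.
  by apply/andP; split; rewrite gt_eqF //; lra.
have hj : j%:R * h = r.
  rewrite /j !natrM -/r -/X -/N /h; field.
  by apply/andP; split; rewrite gt_eqF //; lra.
have hK : K%:R * h <= 5 * r ^+ 2.
  rewrite /K natrD mulrDl hK' [(4 * rho * j)%N%:R]natrM -mulrA hj natrM -/r.
  have : r ^+ 2 / (16 * N) <= r ^+ 2 by rewrite ler_pdivrMr ?ler_peMr ?sqr_ge0 //; lra.
  by nra.
have hhK : h ^+ 2 * K%:R <= 5 * r ^+ 2 * h.
  rewrite (_ : h ^+ 2 * _ = K%:R * h * h); last by ring.
  by rewrite ler_wpM2r // ltW.
have K'K : (K' <= K)%N by rewrite leq_addr.
pose u0 (z : G) : R := - (alpha / 2) * (dist x z - rho)%N%:R.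
have lip : forall i, (i <= K)%N -> lipschitz1 (iter i (flow_step h) u0).
  apply: (flow_gradient N1 cd a0 ell (ltW h0) h6); last by lra.
  exact: initial_gradient.
have center : - 4 <= iter K' (flow_step h) u0 x.
  pose f (z : G) : R := (dist x z)%:R.
  have hf y : 1 - r^-1 * f y <= expR (4^-1 * u0 y).
    rewrite /u0 /f; have [yr|ry] := leqP (dist x y) rho.
      have /eqP -> : (dist x y - rho == 0)%N by rewrite subn_eq0.
      by rewrite !mulr0 expR0 gerBl mulr_ge0 // invr_ge0; lra.
    apply: le_trans (expR_ge0 _); rewrite subr_le0 ler_pdivlMl ?mulr1 ?ler_nat; [exact: ltnW|lra].
  have := flow_lower lip (ltW h0) h1 hf x K'K.
  have hd : 8 * h ^+ 2 * K'%:R <= 1.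
    have : h ^+ 2 * K'%:R <= h ^+ 2 * K%:R by rewrite ler_wpM2l ?sqr_ge0 ?ler_nat.
    by lra.
  have := @heat_displacement _ _ N h f x K' N1 cd (ltW h0) h1 (dist_lipschitz x rev)
    (fun=> ler0n _ _) _ hd.
  rewrite /f dist_refl => /(_ erefl); rewrite -/f hK'.
  set F := iter K' _ f x => hF hv.
  (* By Markov's inequality, a mean distance of at most rho / 2 keeps half of
     the heat within distance rho. *)
  have F2 : F <= r / 2.
    rewrite leNgt; apply/negP => hlt.
    have : (r / 2) ^+ 2 < F ^+ 2 by rewrite ltr_pXn2r // nnegrE; lra.
    have : 4 * N * (r ^+ 2 / (16 * N)) = (r / 2) ^+ 2.
      by field; rewrite gt_eqF //; lra.
    lra.
  have : r^-1 * F <= 2^-1 by rewrite ler_pdivrMl; lra.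
  move=> rF; have half : 2^-1 <= expR (4^-1 * iter K' (flow_step h) u0 x) by lra.
  rewrite leNgt; apply/negP => hlt.
  have : expR (4^-1 * iter K' (flow_step h) u0 x) < expR (- 1).
    by rewrite ltr_expR; lra.
  have : expR (- 1) <= 2^-1 :> R.
    by rewrite expRN lef_pV2 ?posrE ?expR_gt0 //; have := @expR_ge1Dx R 1; lra.
  lra.
pose m := 8 * N ^+ 2 / r ^+ 2.
have r0 : 0 < r by lra.
have N0 : 0 < N by lra.
have hm i y : (K' <= i <= K)%N -> - m <= laplacian (iter i (flow_step h) u0) y.
  move=> /andP[Ki iK].
  apply: le_trans (flow_li_yau lip N1 cd (ltW h0) h6 y iK); rewrite lerN2.
  have -> : m = (K'%:R * (2 * h / N))^-1.
    rewrite (_ : K'%:R * _ = 2 / N * (K'%:R * h)); last by ring.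
    by rewrite hK' /m; field; apply/andP; split; rewrite gt_eqF.
  have q0 : 0 < 2 * h / N by rewrite divr_gt0 //; lra.
  have K'0 : (0 < K'%:R :> R) by rewrite ltr0n /K' muln_gt0 expn_gt0 rho1.
  have iq0 : 0 <= i%:R * (2 * h / N) by rewrite mulr_ge0 // ltW.
  rewrite lef_pV2 ?posrE; [|lra|exact: mulr_gt0].
  apply: le_trans (_ : i%:R * (2 * h / N) <= _); last by lra.
  by rewrite ler_wpM2r ?ler_nat // ltW.
have chain z : z \in ball_seq x (4 * rho) ->
    - (4 + 32 * N ^+ 2 + 8 / alpha) <= iter K (flow_step h) u0 z.
  rewrite mem_ball_seq => dz.
  have := flow_chain lip hm rev a0 a1 ell (ltW h0) h1 (leqnn K) dz.
  rewrite -/K; apply: le_trans.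
  have -> : j%:R * (h * m) = r * m by rewrite mulrA hj.
  have -> : j%:R * (h * alpha / 2) = r * alpha / 2 by rewrite !mulrA hj.
  rewrite natrM -/r.
  have e1 : r * (r * m) = 8 * N ^+ 2 by rewrite /m; field; rewrite gt_eqF.
  have ra0 : 0 < r * alpha by rewrite mulr_gt0.
  have e2 : r * (1 + r * alpha / 2)^-1 <= 2 / alpha.
    rewrite ler_pdivrMr; last by lra.
    rewrite mulrDr mulr1 (_ : 2 / alpha * (r * alpha / 2) = r); last by field; rewrite gt_eqF.
    by rewrite lerDr divr_ge0 // ltW.
  set E := (1 + _)^-1 in e2 *.
  have -> : 4 * r * (r * m + E) = 4 * (r * (r * m)) + 4 * (r * E) by ring.
  rewrite e1; lra.
have q0 : 0 <= expR (- (alpha / 2) * c) by exact: expR_ge0.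
have mass0 : mass_le (fun z : G => expR (c * u0 z)) (2 * volume x rho).
  move=> s us; apply: le_trans (tail_mass rev x a0 ell rho q0 hk us) => //.
  rewrite le_eqVlt; apply/orP; left; apply/eqP; apply: eq_bigr => z _.
  by rewrite /u0 -expRM_natr; congr (_ * expR _); ring.
have := mass_flow rev (ltW h0) h1 lip hb2 mass0 (leqnn K).
move=> /(_ _ (uniq_ball_seq x (4 * rho))) hmass.
set L := 4 + 32 * N ^+ 2 + 8 / alpha in chain *.
have low : expR (- (c * L)) * volume x (4 * rho) <=
    \sum_(z <- ball_seq x (4 * rho)) weight z * expR (c * iter K (flow_step h) u0 z).
  rewrite /volume mulr_sumr big_seq [leRHS]big_seq; apply: ler_sum => z zb.
  rewrite mulrC ler_wpM2l ?(ltW (weight_gt0 z)) // ler_expR -mulrN ler_wpM2l //.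
  exact: chain.
have V0 := volume_ge0 x rho.
have up : (1 + 5 * (h * c) ^+ 2) ^+ K <= expR 1.
  set e := 5 * _; have e0 : 0 <= e by rewrite mulr_ge0 // sqr_ge0.
  apply: le_trans (_ : expR e ^+ K <= _).
    by rewrite lerXn2r ?nnegrE ?expR_ge0 ?expR_ge1Dx //; lra.
  rewrite -expRM_natr ler_expR /e.
  have : c ^+ 2 * (h ^+ 2 * K%:R) <= c ^+ 2 * (5 * r ^+ 2 * h) by rewrite ler_wpM2l ?sqr_ge0.
  move: hb3; rewrite !exprMn; lra.
have tot : expR (- (c * L)) * volume x (4 * rho) <= expR 1 * (2 * volume x rho).
  apply: le_trans low (le_trans hmass _).
  by rewrite ler_wpM2r // mulr_ge0.
rewrite expRD -(ler_pM2l (expR_gt0 (- (c * L)))).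
apply: le_trans tot _; rewrite le_eqVlt; apply/orP; left; apply/eqP.
rewrite expRN; field; rewrite gt_eqF // expR_gt0 //.
Qed.

Lemma gball_volume x (r : R) k :
  (forall z : G, ((dist x z)%:R <= r) = (dist x z <= k)%N) ->
  measure_of (gball x r) = (volume x k)%:E.
Proof.
move=> hr; have -> : gball x r = [set` ball_seq x k].
  by apply/seteqP; split => z /=; rewrite /gball /= mem_ball_seq hr.
rewrite /measure_of esum_fset; first last.
- by move=> z _; rewrite lee_fin ltW // weight_gt0.
- exact: finite_seq.
by rewrite -fsbig_seq ?uniq_ball_seq // sumEFin.
Qed.

End Doubling.

Theorem theorem1p1 (R : realType) (n : nat) (alpha : R)
    (n_ge1 : (1 <= n)%N) (alpha_gt0 : 0 < alpha) :
  exists C_DV : R, 0 < C_DV /\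
    forall G : weightedGraph R,
      bounded_geometry G alpha ->
      CD G 0 n%:R ->
      forall (x : G) (r : R), 0 < r ->
        (measure_of (gball x (2 * r)) <= C_DV%:E * measure_of (gball x r))%E.
Proof.
have [k [k1 hk]] : exists k : nat, (1 <= k)%N /\
    expR (- (alpha / 2) * (2 * k)%N%:R) <= alpha / 2.
  have p0 : 0 <= 2 / alpha ^+ 2 by rewrite divr_ge0 // sqr_ge0.
  exists (Num.bound (2 / alpha ^+ 2)).+1; split => //.
  set k := (Num.bound _).+1.
  have hk : 2 / alpha ^+ 2 <= k%:R by rewrite /k -natr1; have := archi_boundP p0; lra.
  rewrite natrM mulNr expRN -[leRHS]invrK lef_pV2 ?posrE ?expR_gt0 ?invr_gt0 ?divr_gt0 //.
  apply: le_trans (expR_ge1Dx _).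
  have : alpha * (2 / alpha ^+ 2) <= alpha * k%:R by rewrite ler_wpM2l // ltW.
  have -> : alpha * (2 / alpha ^+ 2) = (alpha / 2)^-1 by field; rewrite gt_eqF.
  lra.
pose C := 2 * expR (1 + (2 * k)%N%:R * (4 + 32 * n%:R ^+ 2 + 8 / alpha)).
have C0 : 0 < C by rewrite mulr_gt0 ?expR_gt0.
have ia0 : 0 < alpha^-1 by rewrite invr_gt0.
exists (C + 1 + alpha^-1); split; first by lra.
move=> G [_ ell rev] cd x r r0.
have a1 : alpha <= 1.
  (* p(x, .) has total mass 1, so x has a neighbour, and alpha <= p(x,y) <= 1. *)
  have [y xy] : exists y, adj x y.
    apply: contrapT => none; have := avg1 x.
    rewrite (@eq_avg _ _ x _ (fun=> 0)) ?avg_cst.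
      by move/eqP; rewrite eq_sym oner_eq0.
    by move=> y xy; case: none; exists y.
  apply: le_trans (ell _ _ xy) _.
  by have := sum_kernel_le x (isT : uniq [:: y]); rewrite big_seq1.
pose rho := Num.trunc r.
have [t1 t2] : rho%:R <= r /\ r < rho.+1%:R.
  by have /andP[] := truncn_itv (ltW r0).
have ballP (s : R) : 0 <= s -> forall z : G,
    ((dist x z)%:R <= s) = (dist x z <= Num.trunc s)%N.
  by move=> s0 z; rewrite truncn_ge_nat.
rewrite (gball_volume (ballP r (ltW r0))) -/rho.
rewrite (gball_volume (ballP (2 * r) _)); last by lra.
rewrite -EFinM lee_fin.
have V0 := volume_ge0 x rho.
have cover k' : (Num.trunc (2 * r) <= k')%N ->
    volume x (Num.trunc (2 * r)) <= volume x k'.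
  exact: le_volume.
(* For r < 1 the larger ball has radius at most 1, and one sphere is compared
   with the centre; otherwise 2 r < 2 (rho + 1) <= 4 rho. *)
have [rho0|rho1] := posnP rho.
  apply: le_trans (cover 1%N _) _.
    rewrite -ltnS truncn_lt_nat; last by lra.
    by rewrite rho0 in t2; lra.
  rewrite rho0 in V0 *; rewrite /volume sum_ballS -/(volume x 0) -/(area x 1).
  have := area_growth rev x alpha_gt0 ell 0; have := area_le_volume x 0.
  move=> av0 ag.
  have : alpha^-1 * area x 0 <= alpha^-1 * volume x 0 by rewrite ler_wpM2l // ltW.
  have : 0 <= C * volume x 0 by rewrite mulr_ge0 // ltW.
  rewrite !mulrDl mul1r; lra.
apply: le_trans (cover (4 * rho)%N _) _.
  rewrite -ltnS truncn_lt_nat; last by lra.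
  apply: lt_le_trans (_ : (2 * rho.+1)%N%:R <= _); first by rewrite natrM; lra.
  by rewrite ler_nat; lia.
have := volume_quadruple x n_ge1 alpha_gt0 a1 ell rev cd k1 hk rho1; rewrite -/C.
have : 0 <= (1 + alpha^-1) * volume x rho by rewrite mulr_ge0 //; lra.
lra.
Qed.
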